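(* Let $X$ be a homogeneous space for a group $G$ acting on the right. Regular equivalence relations on $X$ are in one-to-one correspondence with subgroups of $\operatorname{Aut}_G(X)$, in such a way that the equivalence classes are the orbits of the corresponding subgroup. A regular equivalence relation $\sim$ is normal if and only if the corresponding subgroup is normal in $\operatorname{Aut}_G(X)$.
   Context: A homogeneous space $X$ for $G$ is a set with a transitive right $G$-action. $\operatorname{Aut}_G(X)$ is the group of bijections $\varphi\colon X\to X$ commuting with the $G$-action, composed right-to-left, acting on the left of $X$ by $\varphi\cdot x=\varphi(x)$. An equivalence relation $\sim$ on $X$ is homogeneous if $x\sim y$ implies $x\cdot g\sim y\cdot g$ for all $g\in G$. It is regular if it is homogeneous and $\operatorname{Stab}_G(x)=\operatorname{Stab}_G(y)$ whenever $x\sim y$. It is normal if it is regular and $x\sim y$ implies $\varphi(x)\sim\varphi(y)$ for all $\varphi\in\operatorname{Aut}_G(X)$. *)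

(* Defs.v *)
From HB Require Import structures.
From Corelib Require Export Relation_Definitions RelationClasses.
From mathcomp Require Export all_boot.
From mathcomp Require Export boolp classical_sets functions.

Set Implicit Arguments.
Unset Strict Implicit.
Unset Printing Implicit Defensive.

Local Open Scope group_scope.
Local Open Scope classical_set_scope.

(* Transitivity does not force [space] to be nonempty: the empty action is
   allowed. *)
Record homogeneousSpace (G : groupType) := HomogeneousSpace {
  space :> Type;
  act : space -> G -> space;
  act1 : forall x, act x 1 = x;
  actM : forall x g h, act x (g * h) = act (act x g) h;
  act_transitive : forall x y, exists g, act x g = y
}.
Arguments act {G X} x g : rename.

Notation "x · g" := (act x g) (at level 40, left associativity).

Definition stabilizer (G : groupType) (X : homogeneousSpace G) (x : X) : set G :=
  [set g | x · g = x].

Record aut (G : groupType) (X : homogeneousSpace G) := Aut {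
  aut_fun :> X -> X;
  aut_bij : bijective aut_fun;
  aut_act : forall x g, aut_fun (x · g) = aut_fun x · g
}.

Section AutGroup.
Variables (G : groupType) (X : homogeneousSpace G).
Implicit Types f h k : aut X.

Lemma aut_inj f h : f =1 h -> f = h.
Proof.
case: f h => [f bf ef] [h bh eh] /= /funext fh; rewrite {}fh in bf ef *.
by rewrite (Prop_irrelevance bf bh) (Prop_irrelevance ef eh).
Qed.

Definition aut_one : aut X :=
  @Aut G X idfun (Bijective (fun=> erefl) (fun=> erefl)) (fun _ _ => erefl).

Lemma aut_mul_act f h x g : (f \o h) (x · g) = (f \o h) x · g.
Proof. by rewrite /= !aut_act. Qed.

Definition aut_mul f h : aut X :=
  Aut (bij_comp (aut_bij f) (aut_bij h)) (aut_mul_act f h).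

Lemma aut_inv_subproof f : exists f' : X -> X, cancel f f' /\ cancel f' f.
Proof. by case: (aut_bij f) => f' fK f'K; exists f'. Qed.

Definition aut_inv_fun f : X -> X := projT1 (cid (aut_inv_subproof f)).

Lemma aut_funK f : cancel f (aut_inv_fun f).
Proof. exact: (projT2 (cid (aut_inv_subproof f))).1. Qed.

Lemma aut_inv_funK f : cancel (aut_inv_fun f) f.
Proof. exact: (projT2 (cid (aut_inv_subproof f))).2. Qed.

Lemma aut_inv_act f x g : aut_inv_fun f (x · g) = aut_inv_fun f x · g.
Proof.
by apply: (can_inj (aut_funK f)); rewrite aut_act !aut_inv_funK.
Qed.

Definition aut_inv f : aut X :=
  Aut (Bijective (aut_inv_funK f) (aut_funK f)) (aut_inv_act f).

Lemma aut_mulA : associative aut_mul.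
Proof. by move=> f h k; apply: aut_inj. Qed.

Lemma aut_mul1 : left_id aut_one aut_mul.
Proof. by move=> f; apply: aut_inj. Qed.

Lemma aut_mulr1 : right_id aut_one aut_mul.
Proof. by move=> f; apply: aut_inj. Qed.

Lemma aut_mulV : left_inverse aut_one aut_inv aut_mul.
Proof. by move=> f; apply: aut_inj => x /=; rewrite aut_funK. Qed.

Lemma aut_mulrV : right_inverse aut_one aut_inv aut_mul.
Proof. by move=> f; apply: aut_inj => x /=; rewrite aut_inv_funK. Qed.

(* [groupType] inherits from [choiceType]; the equality and choice operators
   come from the classical axioms and carry no mathematical content.
   The product is [f * h = f \o h], so [aut X] acts on [X] on the left. *)
HB.instance Definition _ := gen_eqMixin (aut X).
HB.instance Definition _ := gen_choiceMixin (aut X).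
HB.instance Definition _ := isGroup.Build (aut X)
  aut_mulA aut_mul1 aut_mulr1 aut_mulV aut_mulrV.

End AutGroup.

(* [group_closed] is MathComp's closure predicate: contains 1 and is closed
   under (u, v) |-> u * v^-1. *)
Definition is_subgroup (K : groupType) (H : set K) : Prop :=
  group_closed (mem H).

(* [h ^ k] is the conjugate k^-1 * (h * k). *)
Definition is_normal_subgroup (K : groupType) (H : set K) : Prop :=
  is_subgroup H /\ forall h k, H h -> H (h ^ k).

Definition aut_orbit (G : groupType) (X : homogeneousSpace G)
    (H : set (aut X)) (x : X) : set X :=
  [set f x | f in H].

Section EquivalenceRelations.
Variables (G : groupType) (X : homogeneousSpace G).
Implicit Type R : relation X.

Definition homogeneous_rel R : Prop :=
  Equivalence R /\ forall x y g, R x y -> R (x · g) (y · g).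

Definition regular_rel R : Prop :=
  homogeneous_rel R /\ forall x y, R x y -> stabilizer x = stabilizer y.

Definition normal_rel R : Prop :=
  regular_rel R /\ forall x y (f : aut X), R x y -> R (f x) (f y).

End EquivalenceRelations.

(* Main.v *)
Require Import Defs.

(** A homogeneous space is a single orbit, which controls its automorphisms
    from both sides. They are rigid: an automorphism is determined by its
    value at one point ([aut_eq_at]). And they are plentiful: [x] can be moved
    to [y] by an automorphism as soon as [x] and [y] have the same stabilizer,
    the automorphism being x · g |-> y · g ([aut_of_stabilizer]).

    A relation [R] is sent to the group [class_stable R] of automorphisms that
    keep every point in its class, and a subgroup [H] to the relation
    [orbit_rel H] of lying in the same [H]-orbit. If [R] is regular, then two
    [R]-related points have the same stabilizer, so plentifulness provides an
    automorphism between them; it lies in [class_stable R] because [R] is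
    invariant under the action, whence the classes of [R] are the orbits of
    [class_stable R] ([class_stable_orbit]). Conversely, an automorphism that
    stabilizes the [H]-orbits agrees with some element of [H] at one point,
    hence everywhere by rigidity ([class_stableK]). The two maps are therefore
    mutually inverse.

    If an automorphism [k] is used to transport [R] to another relation, the
    classes of the new relation are the images of the old ones under [k], so
    the group attached to it is the conjugate k * class_stable R * k^-1. Since
    the correspondence is injective, the group is stable under conjugation
    exactly when [R] is invariant under all automorphisms. *)

Local Open Scope group_scope.
Local Open Scope classical_set_scope.

Section Correspondence.
Set Implicit Arguments.
Unset Strict Implicit.
Variables (G : groupType) (X : homogeneousSpace G).
Implicit Types (x y z : X) (f h k : aut X) (R : relation X) (H : set (aut X)).

Lemma actK x (g : G) : x · g · g^-1 = x.
Proof. by rewrite -actM mulgV act1. Qed.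

Lemma actVK x (g : G) : x · g^-1 · g = x.
Proof. by rewrite -actM mulVg act1. Qed.

(** Both sides commute with the action, and the action reaches every point
    from [x]. *)
Lemma aut_eq_at f h x : f x = h x -> f = h.
Proof.
move=> fhx; apply: aut_inj => y; have [g <-] := act_transitive x y.
by rewrite !aut_act fhx.
Qed.

Lemma stabilizer_aut f x : stabilizer (f x) = stabilizer x.
Proof.
apply/seteqP; split=> g; rewrite /stabilizer /= -aut_act; last by move->.
exact: (bij_inj (aut_bij f)).
Qed.

(** Equality of stabilizers is what makes x · g |-> y · g well defined. *)
Lemma act_eq_stabilizer x y (g g' : G) : stabilizer x = stabilizer y ->
  x · g = x · g' -> y · g = y · g'.
Proof.
move=> sxy exg; have : stabilizer x (g * g'^-1).
  by rewrite /stabilizer /= actM exg actK.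
by rewrite sxy /stabilizer /= actM => {2}<-; rewrite actVK.
Qed.

(** The automorphism is x · g |-> y · g. To turn it into a function, some [c z]
    with x · c z = z is chosen for every [z]; by [act_eq_stabilizer] the choice
    is immaterial, and exchanging [x] and [y] gives the inverse. *)
Lemma aut_of_stabilizer x y : stabilizer x = stabilizer y ->
  exists f, f x = y.
Proof.
move=> sxy; pose c z := projT1 (cid (act_transitive x z)).
have cE z : x · c z = z := projT2 (cid (act_transitive x z)).
pose d z := projT1 (cid (act_transitive y z)).
have dE z : y · d z = z := projT2 (cid (act_transitive y z)).
have cK : cancel (fun z => y · c z) (fun z => x · d z).
  by move=> z; rewrite -{2}(cE z); apply: act_eq_stabilizer (esym sxy) (dE _).
have dK : cancel (fun z => x · d z) (fun z => y · c z).
  by move=> z; rewrite -{2}(dE z); apply: act_eq_stabilizer sxy (cE _).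
have c_act z g : y · c (z · g) = y · c z · g.
  by rewrite -actM; apply: act_eq_stabilizer sxy _; rewrite cE actM cE.
exists (Aut (Bijective cK dK) c_act) => /=.
by rewrite -[RHS]act1; apply: act_eq_stabilizer sxy _; rewrite cE act1.
Qed.

Lemma is_subgroupP (K : groupType) (A : set K) :
  is_subgroup A <-> A 1 /\ forall u v, A u -> A v -> A (u * v^-1).
Proof.
split=> -[A1 AV]; split; first by have /set_mem := A1.
- by move=> u v /mem_set Au /mem_set Av; have /set_mem := AV u v Au Av.
- exact/mem_set.
- by move=> u v /set_mem Au /set_mem Av; apply/mem_set/AV.
Qed.

Definition class_stable R : set (aut X) := [set f | forall x, R x (f x)].

Definition orbit_rel H : relation X := fun x y => aut_orbit H x y.

Lemma class_stable_subgroup R : Equivalence R -> is_subgroup (class_stable R).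
Proof.
case=> Rr Rs Rt; apply/is_subgroupP; split=> [x|f h Rf Rh x]; first exact: Rr.
have Rhx := Rh (aut_inv_fun h x); rewrite aut_inv_funK in Rhx.
exact: Rt (Rs _ _ Rhx) (Rf _).
Qed.

(** Regularity enters twice: equal stabilizers provide an automorphism that
    joins two related points, and homogeneity spreads the relation from this
    pair to all pairs (z, f z). *)
Lemma class_stable_orbit R : regular_rel R ->
  orbit_rel (class_stable R) = R.
Proof.
move=> [[[Rr Rs Rt] Rg] Rstab]; apply/funext => x; apply/funext => y.
apply/propext; split=> [[f Rf <-]|Rxy]; first exact: Rf.
have [f fx] := aut_of_stabilizer (Rstab _ _ Rxy); exists f => // z.
(* Every pair (z, f z) is a translate of (x, y). *)
have [g <-] := act_transitive x z.
by rewrite aut_act fx; apply: Rg.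
Qed.

Lemma orbit_rel_regular H : is_subgroup H -> regular_rel (orbit_rel H).
Proof.
move=> /is_subgroupP[H1 HV].
have Hinv f : H f -> H f^-1 by move=> Hf; rewrite -[f^-1]mul1g; apply: HV.
split; last by move=> x _ [f _ <-]; rewrite stabilizer_aut.
split; last by move=> x _ g [f Hf <-]; exists f; rewrite ?aut_act.
split=> [x|x _ [f Hf <-]|x _ _ [f Hf <-] [h Hh <-]]; first by exists 1.
- by exists f^-1; [apply: Hinv | apply: aut_funK].
- by exists (h * f) => //; rewrite -[f]invgK; apply: HV => //; apply: Hinv.
Qed.

(** A priori the element of [H] that takes [x] to [f x] varies with [x];
    rigidity shows that it is always [f] itself. *)
Lemma class_stableK H : is_subgroup H -> class_stable (orbit_rel H) = H.
Proof.
move=> /is_subgroupP[H1 _]; apply/seteqP; split=> f Hf; last by exists f.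
(* On an empty space the only automorphism is the identity. *)
have [[x]|X0] := pselect (inhabited X).
  by have [h Hh /aut_eq_at <-] := Hf x.
suff -> : f = 1 by [].
by apply: aut_inj => x; case: X0; exists.
Qed.

Lemma class_stable_normal R : regular_rel R ->
  normal_rel R <-> is_normal_subgroup (class_stable R).
Proof.
move=> Rreg; have Req := Rreg.1.1; split=> [[_ Raut]|[_ Hconj]].
  split=> [|f k Rf x]; first exact: class_stable_subgroup.
  have := Raut _ _ k^-1 (Rf (k x)).
  by rewrite [k^-1 (k x)](aut_funK k).
split=> // x y k; rewrite -{1}(class_stable_orbit Rreg) => -[f Rf <-].
(* The conjugate k * f * k^-1 sends k x to k (f x). *)
have := Hconj f k^-1 Rf (k x).
rewrite /conjg invgK.
by rewrite [(k * (f * k^-1)) (k x)]/(k (f (aut_inv_fun k (k x)))) aut_funK.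
Qed.

End Correspondence.

Theorem proposition2p6 (G : groupType) (X : homogeneousSpace G) :
  exists F : relation X -> set (aut X),
    set_bij [set R | regular_rel R] [set H | is_subgroup H] F /\
    forall R : relation X, regular_rel R ->
      (forall x : X, [set y | R x y] = aut_orbit (F R) x) /\
      (normal_rel R <-> is_normal_subgroup (F R)).
Proof.
exists (@class_stable G X); split; last first.
  move=> R Rreg; split; last exact: class_stable_normal.
  by move=> x; rewrite -[in LHS](class_stable_orbit Rreg).
split=> [R [[Req _] _]|R S /set_mem Rreg /set_mem Sreg RS|H Hsub].
- exact: class_stable_subgroup.
- by rewrite -(class_stable_orbit Rreg) RS class_stable_orbit.
- exists (orbit_rel H); first exact: orbit_rel_regular.
  exact: class_stableK.
Qed.
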